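(* Let $d \geq 3$, let $T$ be the infinite $d$-regular tree with origin $o$, and for an integer $r\ge 0$ let $B_r = \{x \in T : |x| \leq r\}$, where $|x|$ is the number of edges in the path from $o$ to $x$. Write $$b_r = \# B_r = 1 + d\,\frac{(d-1)^r-1}{d-2}.$$ Let $A_n$ ($n\ge 1$) be the region formed by rotor-router aggregation in $T$ starting from $n$ chips at $o$. If the initial rotor configuration is acyclic, then $A_{b_r} = B_r$ for all $r\ge 0$.
   Context: Rotor-router walk on $T$: for each vertex of $T$ a cyclic ordering of its $d$ neighbors is fixed (arbitrarily), and each vertex carries a rotor pointing to one of its neighbors. When a chip is at a vertex $v$, the rotor at $v$ first advances to the next neighbor in the cyclic ordering at $v$, and then the chip moves to the neighbor to which the newly rotated rotor points. Rotor-router aggregation: $A_1=\{o\}$ and, for $n>1$, $A_n = A_{n-1}\cup\{x_n\}$, where $x_n\in T$ is the endpoint of a rotor-router walk started at $o$ and stopped on first exiting $A_{n-1}$. The rotors are not reset between chips: each walk starts with the rotor configuration left by the previous one (the first walk, producing $x_2$, starts from the initial rotor configuration). A rotor configuration on $T$ is acyclic if there is no pair of neighboring vertices $x,y$ such that the rotor at $x$ points to $y$ and the rotor at $y$ points to $x$. *)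

(* Defs.v *)
From mathcomp Require Import all_boot.
From mathcomp Require Import boolp classical_sets cardinality.

Set Implicit Arguments.
Unset Strict Implicit.
Unset Printing Implicit Defensive.

Local Open Scope classical_set_scope.
Local Open Scope card_scope.

(* A graph is a vertex type V with a boolean adjacency relation adj. *)
Section Graph.
Variables (V : choiceType) (adj : rel V).

Definition connected_graph : Prop :=
  forall x y : V, exists2 p : seq V, path adj x p & last x p = y.

(* ucycle lists the vertices of a closed walk without repetition, so an edge
   traversed back and forth is a ucycle of size 2; genuine cycles have size at
   least 3. *)
Definition cycle_free : Prop := forall c : seq V, ucycle adj c -> size c < 3.

Definition is_tree : Prop :=
  [/\ symmetric adj, irreflexive adj, connected_graph & cycle_free].

Definition regular_graph (d : nat) : Prop :=
  forall v : V, [set y | adj v y] #= `I_d.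

Definition is_simple_path (x y : V) (p : seq V) : Prop :=
  [/\ path adj x p, last x p = y & uniq (x :: p)].

(* The path from x to y in a tree, given by its vertices other than x; its size
   is therefore its number of edges. *)
Definition tree_path (x y : V) : seq V :=
  xget [::] [set p | is_simple_path x y p].

Definition tree_dist (x y : V) : nat := size (tree_path x y).

Definition ball (o : V) (r : nat) : set V := [set x | tree_dist o x <= r].

(* A cyclic ordering of the neighbors of v is given by a duplicate-free list of
   them, in which the last element is followed by the first (see path.next). *)
Definition cyclic_orderings (cyc : V -> seq V) : Prop :=
  forall v : V, uniq (cyc v) /\ cyc v =i adj v.

Definition rotor_config (rho : V -> V) : Prop := forall v : V, adj v (rho v).

Definition acyclic_rotors (rho : V -> V) : Prop :=
  ~ exists x y : V, [/\ adj x y, rho x = y & rho y = x].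

End Graph.

Section RotorRouter.
Variables (V : choiceType) (cyc : V -> seq V).

(* A state is the position of the chip and the current rotors. *)
Definition rotor_step (s : V * (V -> V)) : V * (V -> V) :=
  let: (v, rho) := s in
  let w := next (cyc v) (rho v) in
  (w, fun u => if u == v then w else rho u).

Definition first_exit (A : set V) (s : V * (V -> V)) (t : nat) : Prop :=
  ~ A (iter t rotor_step s).1 /\ forall u, u < t -> A (iter u rotor_step s).1.

(* If the walk never exited A, this would be the initial state s, and the
   aggregation below would then gain no vertex when A contains the origin. *)
Definition walk_until_exit (A : set V) (s : V * (V -> V)) : V * (V -> V) :=
  iter (xget 0 [set t | first_exit A s t]) rotor_step s.

(* Region and rotors after k further chips have been added to {o}. *)
Fixpoint aggregate (o : V) (rho0 : V -> V) (k : nat) : set V * (V -> V) :=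
  if k is j.+1 then
    let: (A, rho) := aggregate o rho0 j in
    let: (x, rho') := walk_until_exit A (o, rho) in
    (A `|` [set x], rho')
  else ([set o], rho0).

(* A_n for n >= 1; the value at n = 0 is irrelevant. *)
Definition region (o : V) (rho0 : V -> V) (n : nat) : set V :=
  (aggregate o rho0 n.-1).1.

End RotorRouter.

(* The division is exact. *)
Definition ball_size (d r : nat) : nat :=
  1 + d * (((d - 1) ^ r - 1) %/ (d - 2)).

(* Main.v *)
(** While the region grows from the ball of radius r to that of radius r + 1,
    exactly N = d (d-1)^r chips are emitted. Consider the hypothetical odometer
    in which each vertex v of the ball makes u(v) = 1 + (d-1) + ... +
    (d-1)^(r-|v|) full turns of its rotor. It satisfies
    d u(v) = N [v = o] + sum of u over the neighbors of v, and u = 1 on the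
    sphere of radius r. A least action principle shows that the actual walks
    never fire v more than d u(v) times. Therefore the walks terminate and every
    vertex of the sphere of radius r + 1 receives at most one chip, from its
    parent. So no chip reenters an occupied vertex of that sphere, and the N
    chips occupy its N vertices. *)
Require Import Defs.
From mathcomp Require Import all_boot zify.
From mathcomp Require Import finmap.
From mathcomp Require Import boolp classical_sets cardinality.

Set Implicit Arguments.
Unset Strict Implicit.
Unset Printing Implicit Defensive.

Local Open Scope classical_set_scope.
Local Open Scope card_scope.

(** * Finite lists and rotation of a cyclic list *)

Lemma card_eq_seq (T : choiceType) (s : seq T) :
  uniq s -> [set x | x \in s] #= `I_(size s).
Proof.
move=> us; have -> : [set x | x \in s] = [set` [fset x in s]%fset].
  by apply/seteqP; split=> x /=; rewrite !inE.
by apply/card_eq_fsetP; rewrite card_fseq undup_id.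
Qed.

Lemma uniq_flatten_map (S T : eqType) (f : S -> seq T) (s : seq S) :
    uniq s -> (forall x, uniq (f x)) ->
    (forall x y z, z \in f x -> z \in f y -> x = y) ->
  uniq (flatten (map f s)).
Proof.
move=> us uf disj; elim: s us => //= x s IH /andP[xs us].
rewrite cat_uniq uf IH // andbT /=; apply/hasPn => z /flatten_mapP[y ys zy].
by apply: contra xs => /(disj _ _ _ zy) <-.
Qed.

Section CyclicList.
Variables (T : eqType) (c : seq T) (x : T).
Hypotheses (uc : uniq c) (xc : x \in c).

Lemma iter_next_in k : iter k (next c) x \in c.
Proof. by elim: k => // k IH; rewrite iterS mem_next. Qed.

Lemma perm_traject_next : perm_eq (traject (next c) (next c x) (size c)) c.
Proof.
have [i p cE] := rot_to xc.
have := cycle_next uc; rewrite -(rot_cycle i) cE (cycle_path x) /=.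
case/andP=> lx px.
have /fpathE : fpath (next c) x (rcons p x) by rewrite rcons_path px.
rewrite size_rcons -[(size p).+1]/(size (x :: p)) -cE size_rot => <-.
by rewrite perm_rcons -cE perm_rot.
Qed.

Lemma iter_next_size : iter (size c) (next c) x = x.
Proof.
have [i p cE] := rot_to xc.
have := cycle_next uc; rewrite -(rot_cycle i) cE (cycle_path x) /=.
case/andP=> lx px.
have /fpathE e : fpath (next c) x (rcons p x) by rewrite rcons_path px.
rewrite -(size_rot i) cE -[RHS](last_rcons x p x) e size_rcons /=.
by rewrite last_traject -iterSr.
Qed.

(** Each full turn visits every entry once and returns to [x], so [k] turns of a rotor send exactly
    [k] chips to each neighbor. *)
Lemma count_traject_next k w : w \in c ->
  count_mem w (traject (next c) (next c x) (size c * k)) = k.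
Proof.
move=> wc.
elim: k => [|k IH]; first by rewrite muln0.
rewrite mulnS addnC trajectD count_cat IH.
have -> : iter (size c * k) (next c) (next c x) = next c x.
  rewrite -iterSr iterS; congr (next c _).
  by elim: {IH} k => [|k IH]; rewrite ?muln0 // mulnS iterD IH iter_next_size.
by rewrite (permP perm_traject_next) (count_uniq_mem _ uc) wc addn1.
Qed.

End CyclicList.

(** * Simple paths, levels and parents in a tree *)

Section Tree.
Variables (V : choiceType) (adj : rel V) (o : V).
Hypothesis (hT : is_tree adj).

(** Strip the common beginning. Where the paths part, follow one up to its first vertex [z] on the
    other and return along the other: this closes a cycle. *)
Lemma simple_path_unique x y p q :
  is_simple_path adj x y p -> is_simple_path adj x y q -> p = q.
Proof.
have [sym _ _ acyc] := hT.
elim: p x q => [|a p IH] x [|b q] //=.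
- case=> _ /= <- _ [_ /= ly /andP[]].
  by rewrite -{1}ly mem_last.
- case=> _ /= <- /andP[xq _] [_ /= e _]; move: xq.
  by rewrite {1}e mem_last.
case=> /= /andP[xa pa] lp /andP[xp up] [/= /andP[xb qb] lq /andP[xq uq]].
have [eab|nab] := eqVneq a b.
  by rewrite -eab in qb lq uq *; congr cons; apply: (IH a).
exfalso.
have hp : has (mem (b :: q)) (a :: p).
  by apply/hasP; exists y; [rewrite -lp mem_last | rewrite /= -lq mem_last].
have xpa : path adj x (a :: p) by rewrite /= xa.
have xqb : path adj x (b :: q) by rewrite /= xb.
have uxp : uniq (x :: a :: p) by rewrite /= xp.
have uxq : uniq (x :: b :: q) by rewrite /= xq.
have [n1 n2] : head x (a :: p) = a /\ head x (b :: q) = b by [].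
move: n1 n2 xpa xqb uxp uxq hp.
move: (a :: p) (b :: q) => {xp xq up uq pa qb IH lp lq xa xb}P Q.
move=> n1 n2 pP pQ uP uQ hPQ.
case: (split_find hPQ) n1 pP uP => z P1 P2 zQ dis n1 pP uP.
have {}zQ : z \in Q by [].
case/splitPr: zQ n2 pQ uQ dis => Q1 Q2 n2 pQ uQ dis.
have {}pP : path adj x (rcons P1 z) by move: pP; rewrite cat_path => /andP[].
have {}pQ : path adj x (rcons Q1 z).
  by move: pQ; rewrite -cat_rcons cat_path => /andP[].
have {}uP : uniq (x :: rcons P1 z).
  by move: uP; rewrite -cat_cons cat_uniq => /andP[].
have {}uQ : uniq (x :: rcons Q1 z).
  by move: uQ; rewrite -cat_rcons -cat_cons cat_uniq => /andP[].
have /acyc : ucycle adj (x :: rcons P1 z ++ rev Q1).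
  apply/andP; split.
    rewrite /= rcons_cat -rev_cons cat_path pP last_rcons /=.
    have := rev_path adj x (rcons Q1 z).
    rewrite last_rcons belast_rcons => ->.
    by rewrite (eq_path (e' := adj)) // => u v; rewrite /= sym.
  rewrite -cat_cons cat_uniq uP rev_uniq /=.
  move: uQ; rewrite /= rcons_uniq mem_rcons inE negb_or.
  case/and3P=> /andP[xz xQ1] zQ1 ->; rewrite andbT.
  apply/hasPn => v; rewrite mem_rev => vQ; rewrite inE negb_or.
  apply/andP; split; first by apply: contraNneq xQ1 => <-.
  rewrite mem_rcons inE negb_or; apply/andP; split.
    by apply: contraNneq zQ1 => <-.
  apply: contra dis => vP; apply/hasP; exists v => //=.
  by rewrite mem_cat vQ.
rewrite /= size_cat size_rcons size_rev.
(* Size below 3 forces [P1] and [Q1] to be empty, so both paths begin with [z], against [nab]. *)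
case: P1 n1 {pP uP dis} => [|u P1] /=; last by lia.
case: Q1 n2 {pQ uQ} => [|u Q1] /=; last by lia.
by move=> eb ea; rewrite -ea eb eqxx in nab.
Qed.

Lemma tree_pathP x y : is_simple_path adj x y (tree_path adj x y).
Proof.
have [_ _ conn _] := hT.
have [p pp lp] := conn x y.
apply: (@xgetPex _ [::] [set p | is_simple_path adj x y p]).
move: lp; case/shortenP: pp => q pq uq _ lq; by exists q.
Qed.

Lemma tree_pathE x y p : is_simple_path adj x y p -> tree_path adj x y = p.
Proof. exact/simple_path_unique/tree_pathP. Qed.

Local Notation level := (tree_dist adj o).
Local Notation tpath := (tree_path adj o).

Lemma tree_dist_root : level o = 0.
Proof. by rewrite /tree_dist (@tree_pathE _ _ [::]). Qed.

Lemma tree_dist_eq0 v : (level v == 0) = (v == o).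
Proof.
apply/eqP/eqP => [/size0nil e|->]; last exact: tree_dist_root.
by have [_ ] := tree_pathP o v; rewrite e.
Qed.

(** If [w] is off the path to [v], append it. Otherwise the segment up to [w], followed by [v], is
    simple, hence is the path to [v]. *)
Lemma tree_path_adj v w : adj v w ->
  tpath w = rcons (tpath v) w \/ tpath v = rcons (tpath w) v.
Proof.
have [sym irr _ _] := hT => vw.
have [pv lv uv] := tree_pathP o v.
have [wv|wv] := boolP (w \in o :: tpath v); last first.
  left; apply: tree_pathE; split.
  - by rewrite rcons_path pv lv.
  - by rewrite last_rcons.
  - by rewrite -rcons_cons rcons_uniq wv.
right.
have [p [q [e lp]]] : exists p q, tpath v = p ++ q /\ last o p = w.
  by case/splitPl: wv => p q lp; exists p, q.
rewrite e cat_path last_cat -cat_cons cat_uniq lp in pv lv uv.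
have [/andP[pp _] /and3P[up /hasPn dis _]] := (pv, uv).
have ep : tpath w = p by apply: tree_pathE; split.
apply: tree_pathE; split.
- by rewrite rcons_path ep pp lp sym.
- by rewrite last_rcons.
- rewrite ep -rcons_cons rcons_uniq up andbT; apply: dis.
  case: q lv {e pv uv} => [/= e|a q /= <-]; last exact: mem_last.
  by rewrite e irr in vw.
Qed.

Lemma tree_dist_adj v w : adj v w ->
  level w = (level v).+1 \/ level v = (level w).+1.
Proof.
rewrite /tree_dist => /tree_path_adj[->|->]; rewrite size_rcons; first by left.
by right.
Qed.

(** A neighbor one level down is the penultimate vertex on the path from [o]. *)
Lemma parent_unique v w w' : adj v w -> adj v w' ->
  level v = (level w).+1 -> level v = (level w').+1 -> w = w'.
Proof.
have par u : adj v u -> level v = (level u).+1 -> tpath v = rcons (tpath u) v.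
  move=> /tree_path_adj[]; rewrite /tree_dist => -> //.
  by rewrite size_rcons; lia.
move=> vw vw' /(par _ vw) e /(par _ vw'); rewrite e => /rcons_inj[ee].
by have [[_ <- _] [_ <- _]] := (tree_pathP o w, tree_pathP o w'); rewrite ee.
Qed.

Lemma parent_exists v : v != o -> exists2 w, adj v w & level v = (level w).+1.
Proof.
have [sym _ _ _] := hT; rewrite -tree_dist_eq0 /tree_dist => vo.
have [] := tree_pathP o v.
case/lastP: (tpath v) vo => // p z _.
rewrite rcons_path last_rcons -rcons_cons rcons_uniq.
case/andP=> pp az zv /andP[_ up]; rewrite -zv size_rcons.
exists (last o p); first by rewrite sym.
by rewrite (@tree_pathE o (last o p) p).
Qed.


(** * Sizes of spheres and balls in the regular tree *)

Variables (d : nat) (cyc : V -> seq V).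
Hypotheses (hd : 3 <= d) (hreg : regular_graph adj d).
Hypothesis (hcyc : cyclic_orderings adj cyc).

Lemma mem_cyc v w : (w \in cyc v) = adj v w.
Proof. by have [_ ->] := hcyc v. Qed.

Lemma uniq_cyc v : uniq (cyc v).
Proof. by have [] := hcyc v. Qed.

Lemma size_cyc v : size (cyc v) = d.
Proof.
apply/esym/card_eq_II/card_eq_trans/card_eq_seq/uniq_cyc.
rewrite card_eq_sym; have -> // : [set x | x \in cyc v] = [set y | adj v y].
by apply/seteqP; split=> x /=; rewrite mem_cyc.
Qed.

Lemma sum_neighbors_root (F : nat -> nat) :
  \sum_(w <- cyc o) F (level w) = d * F 1.
Proof.
rewrite (eq_big_seq (fun=> F 1)) => [|w].
  by rewrite big_const_seq count_predT size_cyc iter_addn_0 mulnC.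
by rewrite mem_cyc => /tree_dist_adj; rewrite tree_dist_root => -[->|].
Qed.

Lemma sum_neighbors (F : nat -> nat) v : v != o ->
  \sum_(w <- cyc v) F (level w) = F (level v).-1 + (d - 1) * F (level v).+1.
Proof.
case/parent_exists=> p vp lp.
have pc : p \in cyc v by rewrite mem_cyc.
rewrite (bigD1_seq p) ?uniq_cyc //= -big_filter lp; congr (F _ + _).
have sz : size [seq w <- cyc v | w != p] = d - 1.
  by rewrite -(size_cyc v) -rem_filter ?uniq_cyc // size_rem // subn1.
rewrite (eq_big_seq (fun=> F (level p).+2)) => [|w].
  by rewrite big_const_seq count_predT sz iter_addn_0 mulnC.
rewrite mem_filter mem_cyc => /andP[wp vw].
case: (tree_dist_adj vw) => [->|lw]; first by rewrite lp.
by rewrite (parent_unique vw vp lw lp) eqxx in wp.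
Qed.

Definition children v := [seq w <- cyc v | level w == (level v).+1].

Fixpoint sphere k : seq V :=
  if k is j.+1 then flatten (map children (sphere j)) else [:: o].

Lemma mem_sphere k x : (x \in sphere k) = (level x == k).
Proof.
have [sym _ _ _] := hT.
elim: k x => [|k IH] x; first by rewrite inE tree_dist_eq0.
apply/flatten_mapP/idP => [[v]|/eqP lx].
  by rewrite IH mem_filter => /eqP-> /andP[].
have /parent_exists[w xw lw] : x != o by rewrite -tree_dist_eq0 lx.
exists w; first by rewrite IH; move: lw; rewrite lx => -[->].
by rewrite mem_filter lw eqxx mem_cyc sym.
Qed.

Lemma uniq_sphere k : uniq (sphere k).
Proof.
have [sym _ _ _] := hT.
case: k => // k; elim: k => [|k IH] //.
  by rewrite /= cats0 filter_uniq ?uniq_cyc.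
apply: uniq_flatten_map IH _ _ => [v|v w z]; first exact/filter_uniq/uniq_cyc.
rewrite !mem_filter !mem_cyc => /andP[/eqP lv vz] /andP[/eqP lw wz].
by apply: (@parent_unique z); rewrite // sym.
Qed.

Lemma size_children v : size (children v) = if v == o then d else d - 1.
Proof.
rewrite size_filter -sum1_count big_mkcond /=.
(* The indicator of the next level turns the count of children into a neighbor sum. *)
pose F k := if k == (level v).+1 then 1 else 0.
rewrite -[LHS]/(\sum_(w <- cyc v) F (level w)).
have [vo|vo] := eqVneq v o.
  by rewrite vo (sum_neighbors_root F) /F vo tree_dist_root muln1.
by rewrite (sum_neighbors F) // /F eqxx muln1; case: eqP => //; lia.
Qed.

Lemma size_sphere k : size (sphere k.+1) = d * (d - 1) ^ k.
Proof.
elim: k => [|k IH]; first by rewrite /= cats0 size_children eqxx muln1.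
rewrite -[sphere k.+2]/(flatten (map children (sphere k.+1))).
rewrite size_flatten /shape -map_comp sumnE big_map.
rewrite (eq_big_seq (fun=> d - 1)) => [|v].
  by rewrite big_const_seq count_predT IH iter_addn_0 expnSr; lia.
by rewrite mem_sphere /= size_children -tree_dist_eq0 => /eqP->.
Qed.

Definition ball_seq r := flatten (map sphere (iota 0 r.+1)).

Lemma mem_ball_seq r x : (x \in ball_seq r) = (level x <= r).
Proof.
apply/flatten_mapP/idP => [[k]|lx].
  by rewrite mem_iota mem_sphere => kr /eqP->; lia.
by exists (level x); rewrite ?mem_iota ?mem_sphere.
Qed.

Lemma uniq_ball_seq r : uniq (ball_seq r).
Proof.
apply: uniq_flatten_map (iota_uniq _ _) uniq_sphere _ => j k x.
by rewrite !mem_sphere => /eqP-> /eqP.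
Qed.

Definition geom m := \sum_(i < m) (d - 1) ^ i.

Lemma geomSr m : geom m.+1 = geom m + (d - 1) ^ m.
Proof. by rewrite /geom big_ord_recr. Qed.

Lemma geomS m : geom m.+1 = (d - 1) * geom m + 1.
Proof.
rewrite /geom big_ord_recl big_distrr addnC /=.
by under eq_bigr do rewrite expnS.
Qed.

Lemma ball_sizeE r : ball_size d r = 1 + d * geom r.
Proof.
rewrite /ball_size [_ ^ _ - 1]subn1 predn_exp.
have -> : (d - 1).-1 = d - 2 by lia.
by rewrite mulKn // subn_gt0.
Qed.

Lemma size_ball_seq r : size (ball_seq r) = ball_size d r.
Proof.
rewrite ball_sizeE; elim: r => [|r IH]; first by rewrite /geom big_ord0 muln0.
have -> : ball_seq r.+1 = ball_seq r ++ sphere r.+1.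
  rewrite /ball_seq -addn1 iotaD map_cat flatten_cat.
  by rewrite [flatten [seq _ | _ <- iota _ 1]]cats0.
by rewrite size_cat IH size_sphere geomSr mulnDr addnA.
Qed.

(** * One phase: from the ball of radius [r] to that of radius [r.+1] *)

Section Phase.
Variables (rho : V -> V) (r : nat).
Hypothesis (hrho : rotor_config adj rho).

(* Firing every vertex of the ball exactly [turns v] full turns would carry
   d * (d - 1) ^ r chips from the root to the sphere of radius r + 1, one to
   each vertex: along each edge below level k the net flow is
   geom (r.+1 - k) - geom (r - k) = (d - 1) ^ (r - k). *)
Definition turns v := geom (r.+1 - level v).

(* [f w] counts the firings of [w] since the rotors were in position [rho]. *)
Definition sent (f : V -> nat) w v :=
  count_mem v (traject (next (cyc w)) (next (cyc w) (rho w)) (f w)).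

Definition received f v := \sum_(w <- cyc v) sent f w v.

Lemma rho_cyc v : rho v \in cyc v.
Proof. by rewrite mem_cyc. Qed.

(** Within budget, the firings of [w] are an initial segment of [turns w] full turns, which send
    exactly [turns w] chips to [v]. *)
Lemma received_le f v : (forall w, f w <= d * turns w) ->
  received f v <= \sum_(w <- cyc v) turns w.
Proof.
have [sym _ _ _] := hT.
move=> hf; rewrite /received big_seq [leqRHS]big_seq; apply: leq_sum => w.
rewrite mem_cyc sym -mem_cyc => vw.
rewrite -[leqRHS](count_traject_next (uniq_cyc w) (rho_cyc w) _ vw) size_cyc.
by rewrite -(subnKC (hf w)) trajectD count_cat leq_addr.
Qed.

(* [n] is the number of chips emitted from the root so far and [C] lists the
   positions of these chips; the last clause is conservation of chips. *)
Definition phase_inv n (C : seq V) f (sigma : V -> V) :=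
  [/\ forall v, sigma v = iter (f v) (next (cyc v)) (rho v),
      forall v, f v <= d * turns v
    & forall v, received f v + n * (v == o) = f v + count_mem v C].

(** At the root this is [geomSr]. Elsewhere, with m = r - level v, it reads geom (m+2) + (d-1) geom
    m = d geom (m+1), which is [geomS] applied twice. *)
Lemma sum_turns v : level v <= r ->
  \sum_(w <- cyc v) turns w + d * (d - 1) ^ r * (v == o) = d * turns v.
Proof.
pose F k := geom (r.+1 - k).
rewrite -[\sum_(w <- _) _]/(\sum_(w <- cyc v) F (level w)).
move=> lv; have [->|vo] := eqVneq v o.
  rewrite (sum_neighbors_root F) /F /turns tree_dist_root.
  by rewrite subn0 subSS subn0 geomSr; lia.
rewrite (sum_neighbors F) // /F /turns muln0 addn0.
have := vo; rewrite -tree_dist_eq0 => v0.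
have -> : r.+1 - (level v).-1 = (r - level v).+2 by lia.
rewrite subSS subSn // !geomS; lia.
Qed.

Lemma sum_turns_boundary v : level v = r.+1 -> \sum_(w <- cyc v) turns w = 1.
Proof.
move=> lv.
pose F k := geom (r.+1 - k).
rewrite -[\sum_(w <- _) _]/(\sum_(w <- cyc v) F (level w)).
rewrite (sum_neighbors F) -?tree_dist_eq0 ?lv //= /F subSn // subnn.
(* Truncated subtraction gives the children no turns; only the parent contributes, with [geom 1]. *)
have -> : r.+1 - r.+2 = 0 by lia.
by rewrite /geom big_ord_recl !big_ord0 muln0.
Qed.

Lemma phase_inv_boundary n C f sigma v :
  phase_inv n C f sigma -> level v = r.+1 -> count_mem v C <= 1.
Proof.
case=> _ hf /(_ v) cons lv.
have := received_le v hf; rewrite sum_turns_boundary //.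
have /eqP := lv; have : v != o by rewrite -tree_dist_eq0 lv.
by move=> /negPf vo _; move: cons; rewrite vo; lia.
Qed.

(* A chip present at [x] was received from the neighbors, within their budgets,
   or emitted; if [x] had exhausted its own budget, all of these chips would
   already have been sent away. *)
Lemma phase_inv_lt n x P f sigma : n <= d * (d - 1) ^ r -> level x <= r ->
  phase_inv n (x :: P) f sigma -> f x < d * turns x.
Proof.
move=> hn lx [_ hf /(_ x)] /=; rewrite eqxx => cons.
have := received_le x hf; have := sum_turns lx; move: cons.
by case: (x == o); lia.
Qed.

Lemma phase_inv_step n x P f sigma (s := rotor_step cyc (x, sigma)) :
    n <= d * (d - 1) ^ r -> level x <= r -> phase_inv n (x :: P) f sigma ->
  phase_inv n (s.1 :: P) (fun v => f v + (v == x)) s.2 /\ level s.1 <= r.+1.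
Proof.
have [sym _ _ _] := hT.
move=> hn lx inv; have fx := phase_inv_lt hn lx inv.
have [hs hf cons] := inv.
have xs : s.1 \in cyc x.
  by rewrite /s /= mem_next hs iter_next_in // rho_cyc.
split; last by move: xs; rewrite mem_cyc => /tree_dist_adj; lia.
split=> v.
- rewrite /s /=; have [->|vx] := eqVneq v x; last by rewrite addn0 hs.
  by rewrite addn1 iterS -hs.
- by have [->|vx] := eqVneq v x; rewrite ?addn1 ?addn0.
pose f' v := f v + (v == x).
(* The extra firing of [x] appends the single entry [s.1] to its trajectory. *)
have sentE w : sent f' w v = sent f w v + (w == x) * (s.1 == v).
  rewrite /sent /f'; case: (eqVneq w x) => [->|_]; last by rewrite !addn0.
  by rewrite addn1 trajectSr -cats1 count_cat /= addn0 mul1n -iterSr iterS -hs.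
have : received (fun v => f v + (v == x)) v = received f v + (s.1 == v).
  rewrite -/f' /received; under eq_bigr do rewrite sentE.
  rewrite big_split -big_distrl /=; congr (_ + _).
  have [<-|_] := eqVneq s.1 v; last by rewrite muln0.
  (* [x] occurs exactly once among the neighbors of [s.1], so the new chip is counted once. *)
  rewrite muln1; have := count_uniq_mem x (uniq_cyc s.1).
  rewrite mem_cyc sym -mem_cyc xs => <-.
  by rewrite -sum1_count [RHS]big_mkcond; apply: eq_bigr => w _ /=; case: eqP.
have := cons v; rewrite /= [v == x]eq_sym; lia.
Qed.

(** The occupied region in mid-phase: the old ball and the endpoints of the walks completed
    since. *)
Definition parked_region (P : seq V) := [set v | level v <= r \/ v \in P].

(** The start [x] is arbitrary so that the induction can follow the walk. It terminates because each
    step inside the ball uses up one unit of the remaining firing budget. *)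
Lemma walk_exits n x (P : seq V) f sigma :
    n <= d * (d - 1) ^ r -> level x <= r.+1 ->
    {in P, forall v, level v = r.+1} ->
    phase_inv n (x :: P) f sigma ->
  exists t f', let s := iter t (rotor_step cyc) (x, sigma) in
    [/\ first_exit cyc (parked_region P) (x, sigma) t, level s.1 = r.+1
      & phase_inv n (s.1 :: P) f' s.2].
Proof.
move=> hn + hP.
have [k] := ubnP (\sum_(v <- ball_seq r) (d * turns v - f v)).
elim: k x f sigma => // k IH x f sigma hk lx inv.
have [lx'|lx'] := leqP (level x) r; last first.
  have {}lx : level x = r.+1 by lia.
  (* On the boundary sphere the walk has exited: were [x] in [P], two chips would share it. *)
  exists 0, f; split=> //; split=> //= -[|xP]; first by lia.
  have := phase_inv_boundary inv lx; rewrite /= eqxx.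
  by case E : (count_mem x P) => [|m] //; move/count_memPn: E; rewrite xP.
have [inv' ls] := phase_inv_step hn lx' inv; have fx := phase_inv_lt hn lx' inv.
move: inv' ls; case E : (rotor_step cyc (x, sigma)) => [y tau] /= inv' ls.
have [|t [f' [[ex1 ex2] lt invt]]] := IH _ _ _ _ ls inv'.
  move: hk; have xb : x \in ball_seq r by rewrite mem_ball_seq.
  rewrite !(bigD1_seq x) ?uniq_ball_seq //= eqxx.
  under [\sum_(i <- _ | i != x) (_ - (f i + _))]eq_bigr => i /negPf->
    do rewrite addn0.
  by move: fx; move: (\sum_(i <- _ | _) _) (d * turns x) => S D; lia.
exists t.+1, f'; rewrite iterSr E; split=> //.
split; first by rewrite iterSr E.
by case=> [_|u ut]; [left | rewrite iterSr E; apply: ex2].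
Qed.

Lemma aggregate_phase rho0 k n :
    aggregate cyc o rho0 k = (ball adj o r, rho) -> n <= d * (d - 1) ^ r ->
  exists P f sigma, [/\ aggregate cyc o rho0 (n + k) = (parked_region P, sigma),
    phase_inv n P f sigma, size P = n & {in P, forall v, level v = r.+1}].
Proof.
move=> hk; elim: n => [_|n IH hn].
  exists [::], (fun=> 0), rho; split=> //.
    rewrite hk; congr pair; apply/seteqP; split=> x /=; first by left.
    by case.
  split=> // v; rewrite /received /sent mul0n addn0 /=; exact: big1.
have [P [f [sigma [hA [hs hf cons] sP hP]]]] := IH (ltnW hn).
(* Emitting a chip adds one at [o] to both sides of the conservation law. *)
have inv : phase_inv n.+1 (o :: P) f sigma.
  by split=> // v; have := cons v; rewrite /= [o == v]eq_sym; lia.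
have lo : level o <= r.+1 by rewrite tree_dist_root.
have [t [f' [ex lt invt]]] := walk_exits hn lo hP inv.
have [_ ex2] := ex.
rewrite addSn /= hA /walk_until_exit.
pose exits := first_exit cyc (parked_region P) (o, sigma).
(* The first exit time is unique, so [xget] selects [t]. *)
rewrite (@xget_unique _ 0 [set t | exits t] t) //; last first.
  move=> t' [ex1' ex2']; have [ex1 _] := ex.
  case: (ltngtP t' t) => //.
    by move=> tt'; case: ex1'; apply: ex2.
  by move=> tt'; case: ex1; apply: ex2'.
move: lt invt; case: (iter t _ _) => y tau /= ly inv'.
exists (y :: P), f', tau; split=> //=; last 2 first.
- by rewrite sP.
- by move=> v; rewrite inE => /predU1P[->|/hP].
congr pair; apply/seteqP; split=> v; rewrite /parked_region /= inE.
  by case=> [[|->]|->]; rewrite ?eqxx ?orbT; [left|right|right].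
by case=> [|/predU1P[|]]; [left; left|right|left; right].
Qed.

Lemma aggregate_next_ball rho0 k :
    aggregate cyc o rho0 k = (ball adj o r, rho) ->
  exists2 rho',
      aggregate cyc o rho0 (d * (d - 1) ^ r + k) = (ball adj o r.+1, rho')
    & rotor_config adj rho'.
Proof.
move=> hk; have [P [f [sigma [-> inv sP hP]]]] := aggregate_phase hk (leqnn _).
exists sigma; last first.
  by case: inv => hs _ _ v; rewrite hs -mem_cyc iter_next_in // rho_cyc.
have uP : uniq P.
  apply: count_mem_uniq => v; have [vP|/count_memPn //] := boolP (v \in P).
  have := phase_inv_boundary inv (hP v vP).
  by case E : (count_mem v P) => [|[|m]] //; move/count_memPn: E; rewrite vP.
have sub : {subset P <= sphere r.+1} by move=> v /hP lv; rewrite mem_sphere lv.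
(* A duplicate-free list inside the sphere and of the same size exhausts it. *)
have [|_ PE] := uniq_min_size uP sub; first by rewrite size_sphere sP.
congr pair; apply/seteqP; split=> v;
  rewrite /parked_region /ball /= PE mem_sphere; lia.
Qed.

End Phase.

(** * Induction over the phases *)

Lemma aggregate_ball rho0 r : rotor_config adj rho0 ->
  exists2 rho, aggregate cyc o rho0 (ball_size d r).-1 = (ball adj o r, rho)
    & rotor_config adj rho.
Proof.
(* The first chip occupies [o] without walking, which leaves [d * geom r] walks. Each phase starts
   from the rotors left by the previous one. *)
move=> h0; rewrite ball_sizeE add1n /=; elim: r => [|r [rho hk hrho]].
  exists rho0 => //; rewrite /geom big_ord0 muln0 /=; congr pair.
  apply/seteqP; split=> v /=; rewrite /ball /= leqn0 tree_dist_eq0.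
    by move->.
  by move/eqP.
have [rho' hk' hrho'] := aggregate_next_ball hrho hk.
by exists rho'; rewrite // geomSr mulnDr addnC.
Qed.

End Tree.

Theorem theorem1p1 (d : nat) (hd : 3 <= d)
    (V : choiceType) (adj : rel V) (o : V)
    (hT : is_tree adj) (hreg : regular_graph adj d)
    (cyc : V -> seq V) (hcyc : cyclic_orderings adj cyc)
    (rho0 : V -> V) (hrho0 : rotor_config adj rho0)
    (hacyc : acyclic_rotors adj rho0) :
  forall r : nat,
    ball adj o r #= `I_(ball_size d r) /\
    region cyc o rho0 (ball_size d r) = ball adj o r.
Proof.
move=> r; split.
  rewrite -(size_ball_seq o hT hd hreg hcyc).
  have -> : ball adj o r = [set x | x \in ball_seq adj o cyc r].
    apply/seteqP; split=> x /=; by rewrite (mem_ball_seq _ hT hd hcyc).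
  exact/card_eq_seq/uniq_ball_seq.
by rewrite /region; have [rho -> _] := aggregate_ball o hT hd hreg hcyc r hrho0.
Qed.
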